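(* Let $\mathcal H$ be a real Hilbert space, $t_0>0$, let $f:\mathcal H\to\mathbb R$ be convex and $\mathcal C^1$ with $L$-Lipschitz continuous gradient and nonempty set of minimizers. Let $\alpha>3$, $\gamma>0$, $\beta\ge0$, $\beta(t)=\gamma+\beta/t$, let $b\in]0,\alpha-1]$ and $$a(t)=t^2\left(1+\frac{(\alpha-b)\gamma t-\beta(\alpha+1-b)}{t^2-\alpha\gamma t-\beta(\alpha+1)}\right),\qquad m(t)=\max\big(t,\,L|a(t)\beta(t)|,\,L|a(t)|\beta(t)^2\big).$$ Let $e\in\mathcal C([t_0,+\infty[;\mathcal H)$ with $m(\cdot)e(\cdot)\in L^1(t_0,+\infty;\mathcal H)$, and let $x$ be a solution of $$\ddot x(t)+\frac\alpha t\dot x(t)+\nabla f\big(x(t)+\beta(t)\dot x(t)\big)+e(t)=0.$$ Then $x(t)$ converges weakly, as $t\to+\infty$, to a minimizer of $f$. *)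

(* Defs.v *)
From HB Require Import structures.
From mathcomp Require Import all_boot all_order all_algebra.
From mathcomp Require Import all_classical all_reals all_analysis.
Set Implicit Arguments. Unset Strict Implicit. Unset Printing Implicit Defensive.
Import Order.TTheory GRing.Theory Num.Theory.
Import numFieldNormedType.Exports.
Local Open Scope classical_set_scope.
Local Open Scope ring_scope.

(* A real Hilbert space is a complete normed space [V] whose norm comes from
   an inner product [ip]: symmetric, bilinear, with ip x x = |x|^2. *)
Definition is_Hilbert_inner (R : realType) (V : normedModType R)
  (ip : V -> V -> R) : Prop :=
  [/\ (forall x y, ip x y = ip y x),
      (forall a x y z, ip (a *: x + y) z = a * ip x z + ip y z) &
      (forall x, ip x x = `|x| ^+ 2)].

Definition convex_fun (R : realType) (V : normedModType R) (f : V -> R) : Prop :=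
  forall (x y : V) (l : R), 0 <= l <= 1 ->
    f (l *: x + (1 - l) *: y) <= l * f x + (1 - l) * f y.

Definition betaf (R : realType) (gamma beta : R) (t : R) : R := gamma + beta / t.

Definition af (R : realType) (alpha gamma beta b : R) (t : R) : R :=
  t ^+ 2 * (1 + ((alpha - b) * gamma * t - beta * (alpha + 1 - b))
                / (t ^+ 2 - alpha * gamma * t - beta * (alpha + 1))).

Definition mf (R : realType) (L alpha gamma beta b : R) (t : R) : R :=
  Num.max t (Num.max (L * `|af alpha gamma beta b t * betaf gamma beta t|)
                     (L * `|af alpha gamma beta b t| * betaf gamma beta t ^+ 2)).

(* Main.v *)
Require Import Defs.
From HB Require Import structures.
From mathcomp Require Import all_boot all_order all_algebra.
From mathcomp Require Import all_classical all_reals all_analysis.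
From mathcomp Require Import measurable_realfun ring lra.
Set Implicit Arguments.
Unset Strict Implicit.
Import Order.TTheory GRing.Theory Num.Theory.
Import numFieldNormedType.Exports.
Local Open Scope classical_set_scope.
Local Open Scope ring_scope.

(** Put [y = x + beta(t) x'] and let [p] be a minimizer.  Since [m(t) >= t], the
perturbation satisfies [t |e| in L^1], and this suffices.  For
[2 <= b < alpha - 1] the energy
[E_b = t^2 (f y - f p) + |b (x - p) + t x'|^2 / 2
       + b (alpha - 1 - b) |x - p|^2 / 2]
satisfies [E_b' <= C t |e| (1 + E_b)] for large [t]: the cross term in
[<grad f y, x'>] is absorbed by [t |x'|^2] and by the dissipation
[t^2 |grad f y|^2] coming from the implicit Hessian damping.  By Gronwall, [E_b]
converges.  [E_b] is affine in [b], so the slope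
[W = t h' + (alpha - 1) h], with [h = |x - p|^2 / 2], converges too, and hence
so does [h].  Moreover [f y -> f p] and [y - x -> 0], so weak cluster points of
[x] are minimizers, and Opial's argument, run along ultrafilters with the Riesz
theorem providing the cluster points, gives weak convergence. *)

(** * Limits and derivatives of vector-valued functions *)

Lemma cvg_dist_le {R : realType} {V : normedModType R} (T : Type)
    (F : set_system T) {FF : Filter F} (u : T -> V) (a : V) (w : T -> R) :
  w @ F --> (0 : R) -> (\forall t \near F, `|u t - a| <= w t) -> u @ F --> a.
Proof.
move=> /cvgrPdist_lt w0 uw; apply/cvgrPdist_lt => e /w0 we.
near=> t; rewrite distrC; apply: (@le_lt_trans _ _ (w t)); first by near: t.
have : `|0 - w t| < e by near: t.
by rewrite sub0r normrN; exact: le_lt_trans (ler_norm _).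
Unshelve. all: by end_near. Qed.

Lemma cvg_dist0 {R : realType} {V : normedModType R} (T : Type)
    (F : set_system T) {FF : Filter F} (u : T -> V) (a : V) :
  u @ F --> a -> (fun t => `|u t - a|) @ F --> (0 : R).
Proof.
move=> ua; have /cvg_norm : (fun t => u t - a) @ F --> a - a.
  by apply: cvgB => //; exact: cvg_cst.
by rewrite subrr normr0.
Qed.

(** Continuity of [w] at [t], in the shape in which the shifted factor occurs in the difference
    quotient of a product. *)
Lemma derivable_cvg_shift {R : realType} {V : normedModType R} (w : R -> V)
    (t : R) :
  derivable w t 1 -> (fun h : R => w (h *: 1 + t)) @ 0^' --> w t.
Proof.
move=> dw; have wt := differentiable_continuous ((derivable1_diffP w t).1 dw).
apply: (@cvg_comp _ _ _ (fun h : R => h *: 1 + t) w _ (nbhs t)) => //.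
apply: cvg_within_filter.
have : (fun h : R => h *: (1 : R^o) + t) @ nbhs (0 : R)
    --> (0 : R) *: (1 : R^o) + t.
  by apply: cvgD; [apply: cvgZr_tmp; exact: cvg_id|exact: cvg_cst].
by rewrite scale0r add0r.
Qed.

Lemma is_derive_scale {R : realType} {V : normedModType R} (k : R -> R)
    (w : R -> V) (t dk : R) (dw : V) :
  is_derive t 1 k dk -> is_derive t 1 w dw ->
  is_derive t 1 (fun s => k s *: w s) (dk *: w t + k t *: dw).
Proof.
move=> [dk1 dk2] [dw1 dw2].
have kcv : (fun h : R => h^-1 *: (k (h *: 1 + t) - k t)) @ 0^' --> dk.
  by rewrite -dk2; exact: dk1.
have wcv : (fun h : R => h^-1 *: (w (h *: 1 + t) - w t)) @ 0^' --> dw.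
  by rewrite -dw2; exact: dw1.
have wc := derivable_cvg_shift dw1.
suff H : (fun h : R => h^-1 *: (k (h *: 1 + t) *: w (h *: 1 + t) - k t *: w t))
    @ 0^' --> dk *: w t + k t *: dw.
  apply: DeriveDef; first by apply/cvg_ex; eexists; exact: H.
  by apply: cvg_lim => //; exact: H.
rewrite (_ : (fun h : R => _) = (fun h : R =>
    (h^-1 *: (k (h *: 1 + t) - k t)) *: w (h *: 1 + t)
    + k t *: (h^-1 *: (w (h *: 1 + t) - w t)))); last first.
  (* The usual splitting for a product rule: [b *: u] is subtracted and added back. *)
  have alg (i a b : R) (u v : V) :
      i *: (a *: u - b *: v) = (i * (a - b)) *: u + b *: (i *: (u - v)).
    by rewrite !scalerBr !scalerA mulrBr scalerBl [b * i]mulrC addrA subrK.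
  by apply/funext => h; exact: alg.
by apply: cvgD; [exact: cvgZ|exact: cvgZl_tmp].
Qed.

(** * Inner product calculus *)

Section InnerProduct.
Context {R : realType} {V : normedModType R} {ip : V -> V -> R}.
Hypothesis Hip : is_Hilbert_inner ip.

Lemma ipC x y : ip x y = ip y x.
Proof. by case: Hip. Qed.

Lemma ipxx x : ip x x = `|x| ^+ 2.
Proof. by case: Hip. Qed.

Lemma ip_lin a x y z : ip (a *: x + y) z = a * ip x z + ip y z.
Proof. by case: Hip. Qed.

Lemma ipDl x y z : ip (x + y) z = ip x z + ip y z.
Proof. by rewrite -[x]scale1r ip_lin mul1r scale1r. Qed.

Lemma ip0l z : ip 0 z = 0.
Proof. by apply: (addrI (ip 0 z)); rewrite -ipDl !addr0. Qed.

Lemma ipZl a x z : ip (a *: x) z = a * ip x z.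
Proof. by rewrite -[a *: x]addr0 ip_lin ip0l addr0. Qed.

Lemma ipNl x z : ip (- x) z = - ip x z.
Proof. by rewrite -scaleN1r ipZl mulN1r. Qed.

Lemma ipBl x y z : ip (x - y) z = ip x z - ip y z.
Proof. by rewrite ipDl ipNl. Qed.

Lemma ipDr x y z : ip z (x + y) = ip z x + ip z y.
Proof. by rewrite ipC ipDl !(ipC z). Qed.

Lemma ip0r z : ip z 0 = 0.
Proof. by rewrite ipC ip0l. Qed.

Lemma ipZr a x z : ip z (a *: x) = a * ip z x.
Proof. by rewrite ipC ipZl ipC. Qed.

Lemma ipNr x z : ip z (- x) = - ip z x.
Proof. by rewrite ipC ipNl ipC. Qed.

Lemma ipBr x y z : ip z (x - y) = ip z x - ip z y.
Proof. by rewrite ipDr ipNr. Qed.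

Definition ipE := (ipDl, ipBl, ipNl, ipZl, ipDr, ipBr, ipNr, ipZr).

Lemma sqnormD x y : `|x + y| ^+ 2 = `|x| ^+ 2 + 2 * ip x y + `|y| ^+ 2.
Proof. by rewrite -!ipxx !ipE (ipC y x); ring. Qed.

Lemma sqnormB x y : `|x - y| ^+ 2 = `|x| ^+ 2 - 2 * ip x y + `|y| ^+ 2.
Proof. by rewrite -!ipxx !ipE (ipC y x); ring. Qed.

Lemma cauchy_schwarz x y : `|ip x y| <= `|x| * `|y|.
Proof.
have [->|y0] := eqVneq y 0; first by rewrite ip0r !normr0 mulr0.
have ny : 0 < `|y| by rewrite normr_gt0.
(* This vector is [|y|^2] times the component of [x] orthogonal to [y]; the scaling avoids
   divisions. *)
have : 0 <= `| `|y| ^+ 2 *: x - ip x y *: y | ^+ 2 by exact: sqr_ge0.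
rewrite sqnormB !normrZ !exprMn !ipE !real_normK ?num_real//.
set c := ip x y; set p := `|x|; set q := `|y| => H.
have q2 : 0 < q ^+ 2 by rewrite exprn_gt0.
have : 0 <= q ^+ 2 * ((p * q) ^+ 2 - c ^+ 2) by apply: le_trans H _; lra.
rewrite pmulr_rge0// subr_ge0 => H2.
rewrite -(@ler_pXn2r _ 2) ?nnegrE// ?mulr_ge0 ?normr_ge0//.
by rewrite real_normK ?num_real.
Qed.

Lemma ip_le x y : ip x y <= `|x| * `|y|.
Proof. exact: le_trans (ler_norm _) (cauchy_schwarz x y). Qed.

Lemma ipN_le x y : - ip x y <= `|x| * `|y|.
Proof. by rewrite -ipNl (le_trans (ip_le _ _))// normrN. Qed.

Lemma cvg_ip (T : Type) (F : set_system T) {FF : Filter F} (u w : T -> V) a c :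
  u @ F --> a -> w @ F --> c -> (fun t => ip (u t) (w t)) @ F --> ip a c.
Proof.
move=> ua wc.
have du := @cvg_dist0 _ _ _ _ FF _ _ ua.
have dw := @cvg_dist0 _ _ _ _ FF _ _ wc.
have nw : (fun t => `|w t|) @ F --> `|c| by exact: cvg_norm.
have H : (fun t => `|u t - a| * `|w t| + `|a| * `|w t - c|) @ F
    --> 0 * `|c| + `|a| * 0.
  by apply: cvgD; apply: cvgM => //; exact: cvg_cst.
rewrite mul0r mulr0 addr0 in H.
apply: (cvg_dist_le H); apply: filterE => t.
have -> : ip (u t) (w t) - ip a c = ip (u t - a) (w t) + ip a (w t - c).
  by rewrite !ipE; ring.
by apply: le_trans (ler_normD _ _) _; apply: lerD; exact: cauchy_schwarz.
Qed.

Lemma is_derive_ip (u w : R -> V) (t : R) (du dw : V) :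
  is_derive t 1 u du -> is_derive t 1 w dw ->
  is_derive t 1 (fun s => ip (u s) (w s)) (ip du (w t) + ip (u t) dw).
Proof.
move=> [du1 du2] [dw1 dw2].
have ucv : (fun h : R => h^-1 *: (u (h *: 1 + t) - u t)) @ 0^' --> du.
  by rewrite -du2; exact: du1.
have wcv : (fun h : R => h^-1 *: (w (h *: 1 + t) - w t)) @ 0^' --> dw.
  by rewrite -dw2; exact: dw1.
have wc := derivable_cvg_shift dw1.
suff H : (fun h : R => h^-1 *:
    (ip (u (h *: 1 + t)) (w (h *: 1 + t)) - ip (u t) (w t))) @ 0^'
    --> ip du (w t) + ip (u t) dw.
  apply: DeriveDef; first by apply/cvg_ex; eexists; exact: H.
  by apply: cvg_lim => //; exact: H.
have -> : (fun h : R => h^-1 *: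
    (ip (u (h *: 1 + t)) (w (h *: 1 + t)) - ip (u t) (w t))) =
  (fun h : R => ip (h^-1 *: (u (h *: 1 + t) - u t)) (w (h *: 1 + t))
    + ip (u t) (h^-1 *: (w (h *: 1 + t) - w t))).
  by apply/funext => h; rewrite !ipE /GRing.scale/=; ring.
apply: cvgD; apply: cvg_ip => //; exact: cvg_cst.
Qed.

End InnerProduct.

(** * Riesz representation by minimization *)

Section Riesz.
Context {R : realType} {V : completeNormedModType R} {ip : V -> V -> R}.
Hypothesis Hip : is_Hilbert_inner ip.

(* The representing vector minimizes [|y|^2 - 2 phi y]; the parallelogram
   identity makes every minimizing sequence Cauchy. *)
Lemma riesz_representation (phi : V -> R) (M : R) :
  (forall a x y, phi (a *: x + y) = a * phi x + phi y) ->
  (forall y, `|phi y| <= M * `|y|) ->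
  exists z : V, forall y, phi y = ip z y.
Proof.
move=> lin bnd.
have phiD x y : phi (x + y) = phi x + phi y.
  by rewrite -[x]scale1r lin mul1r scale1r.
have phi0 : phi 0 = 0 by apply: (addrI (phi 0)); rewrite -phiD !addr0.
have phiZ a x : phi (a *: x) = a * phi x.
  by rewrite -[a *: x]addr0 lin phi0 addr0.
pose J y := `|y| ^+ 2 - 2 * phi y.
have Jlb y : - M ^+ 2 <= J y.
  have : phi y <= M * `|y| by exact: le_trans (ler_norm _) (bnd y).
  rewrite /J => H; have := sqr_ge0 (`|y| - M); lra.
have hinf : has_inf (range J).
  by split; [exists (J 0), 0 | exists (- M ^+ 2) => _ [y _ <-]].
pose m := inf (range J).
have mlb y : m <= J y by apply: ge_inf; [case: hinf | exists y].
have apx n : exists y, J y <= m + n.+1%:R^-1.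
  have n0 : 0 < n.+1%:R^-1 :> R by rewrite invr_gt0.
  have [_ [y _ <-] /ltW H] := inf_adherent n0 hinf.
  by exists y.
have [u hu] := choice apx.
(* The infimum [m] is compared with the value of [J] at the midpoint of [y] and [z]. *)
have paral y z : `|y - z| ^+ 2 <= 2 * (J y - m) + 2 * (J z - m).
  have := mlb (2^-1 *: (y + z)).
  rewrite /J phiZ phiD normrZ exprMn (sqnormB Hip) (sqnormD Hip) ger0_norm//.
  by move=> H; lra.
have cu : cvg (u @ \oo).
  apply/cauchy_cvgP/cauchy_exP => e e0.
  have e40 : 0 < e ^+ 2 / 4 by rewrite divr_gt0// exprn_gt0.
  have [N _ HN] := near_infty_natSinv_lt (PosNum e40).
  have {}HN k : (N <= k)%N -> k.+1%:R^-1 < e ^+ 2 / 4 :> R by exact: HN.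
  exists (u N); exists N => // n /= Nn; rewrite -ball_normE/=.
  rewrite -(@ltr_pXn2r _ 2) ?nnegrE ?normr_ge0 ?(ltW e0)//.
  apply: le_lt_trans (paral _ _) _.
  move: (hu n) (hu N) (HN _ Nn) (HN _ (leqnn N)).
  move: (n.+1%:R^-1) (N.+1%:R^-1) (J (u n)) (J (u N)) (e ^+ 2) => a c p q d.
  by lra.
pose z := lim (u @ \oo).
have cz : u @ \oo --> z by exact: cu.
have phic : continuous phi.
  move=> y.
  have phiB w : phi w - phi y = phi (w - y).
    by rewrite phiD -(scaleN1r y) phiZ mulN1r.
  have H : (fun w => M * `|w - y|) @ y --> (0 : R).
    have : (fun w => M * `|w - y|) @ y --> M * 0.
      by apply: cvgM; [exact: cvg_cst|exact: (cvg_dist0 (@cvg_id _ _))].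
    by rewrite mulr0.
  by apply: (cvg_dist_le H); apply: filterE => w; rewrite phiB.
have Jz : J z <= m.
  have Ju : (J \o u) @ \oo --> J z.
    have nu : `|u n| @[n --> \oo] --> `|z| by apply: cvg_norm; exact: cz.
    apply: cvgB; first by rewrite expr2; apply: cvgM.
    by apply: cvgM; [exact: cvg_cst|exact: cvg_comp cz (phic z)].
  have mu : (fun n => m + n.+1%:R^-1) @ \oo --> m.
    have : (fun n => m + n.+1%:R^-1) @ \oo --> m + 0.
      by apply: cvgD; [exact: cvg_cst|exact: cvg_harmonic].
    by rewrite addr0.
  apply: ler_cvg_to Ju mu _; exact: nearW.
exists z => y.
apply/eqP; rewrite -subr_eq0; apply/eqP; set d := _ - _.
(* First-order optimality: the right-hand side is [J (z + s *: y) - J z]. *)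
have key s : 0 <= s ^+ 2 * `|y| ^+ 2 - 2 * s * d.
  have := le_trans Jz (mlb (z + s *: y)).
  rewrite /J (sqnormD Hip) phiD phiZ normrZ exprMn real_normK ?num_real//.
  rewrite (ipZr Hip) /d.
  by move=> H; lra.
(* The added 1 keeps [q] positive even for [y = 0]; taking [s = d / q] then makes the quadratic
   nonpositive, which forces [d = 0]. *)
pose q := `|y| ^+ 2 + 1.
have q0 : 0 < q by rewrite ltr_wpDl// sqr_ge0.
have := key (d / q).
have -> : (d / q) ^+ 2 * `|y| ^+ 2 - 2 * (d / q) * d
   = - (d / q) ^+ 2 * (q + 1).
  by rewrite /q; field; rewrite -/q gt_eqF.
rewrite mulNr oppr_ge0 pmulr_lle0; last by rewrite addr_gt0.
move=> H; have : (d / q) ^+ 2 = 0 by apply/eqP; rewrite eq_le H sqr_ge0.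
by move/eqP; rewrite sqrf_eq0 mulf_eq0 invr_eq0 (gt_eqF q0) orbF => /eqP.
Unshelve. all: by end_near. Qed.

End Riesz.

(** * Weak limits along ultrafilters and Opial's argument *)

Lemma ultra_cvg_bounded {R : realType} (T : Type) (U : set_system T)
    (phi : T -> R) (M : R) : UltraFilter U ->
  (\forall t \near U, `|phi t| <= M) -> exists l : R, phi @ U --> l.
Proof.
move=> UU bnd.
have UM : (phi @ U) [set` `[- M, M]].
  by apply: filterS bnd => t /=; rewrite in_itv/= ler_norml.
have [l [_ lcl]] := @segment_compact R (- M) M _ (fmap_proper_filter phi _) UM.
exists l => A lA.
(* A cluster point of an ultrafilter is a limit: otherwise the image filter would contain the
   complement of the neighbourhood [A], which has to meet [A]. *)
have [//|UnA] := in_ultra_setVsetC (phi @^-1` A) UU.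
by have [r [? ?]] := lcl (~` A) A UnA lA.
Qed.

Section Opial.
Context {R : realType} {V : completeNormedModType R} {ip : V -> V -> R}.
Hypothesis Hip : is_Hilbert_inner ip.

(** Weak compactness of balls: the limits of [ip (x t) y] exist for each [y] separately, form a
    bounded linear functional of [y], and Riesz represents it. *)
Lemma ultra_weak_cvg_bounded (T : Type) (U : set_system T) (x : T -> V)
    (M : R) : UltraFilter U -> (\forall t \near U, `|x t| <= M) ->
  exists z : V, forall y, ip (x t) y @[t --> U] --> ip z y.
Proof.
move=> UU bnd.
have bndy y : \forall t \near U, `|ip (x t) y| <= M * `|y|.
  apply: filterS bnd => t xM; apply: le_trans (cauchy_schwarz Hip _ _) _.
  by rewrite ler_wpM2r.
have lim_ex y : exists l : R, ip (x t) y @[t --> U] --> l.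
  exact: (ultra_cvg_bounded UU (bndy y)).
have [phi phiP] := choice lim_ex.
have phi_lin a u w : phi (a *: u + w) = a * phi u + phi w.
  apply: (cvg_unique (@norm_hausdorff _ _) (phiP _)).
  rewrite (_ : (fun t => _) = fun t => a * ip (x t) u + ip (x t) w); last first.
    by apply/funext => t; rewrite (ipDr Hip) (ipZr Hip).
  by apply: cvgD => //; apply: cvgM => //; exact: cvg_cst.
have phi_bnd y : `|phi y| <= M * `|y|.
  by apply: cvgr_to_le (bndy y); apply: cvg_norm; exact: phiP.
have [z zP] := riesz_representation Hip phi_lin phi_bnd.
by exists z => y; rewrite -zP.
Qed.

(* A second cluster point [w] coincides with [z]: both [|x - z|^2] and
   [|x - w|^2] converge, hence so does [ip x (z - w)]. *)
Lemma opial (T : Type) (F : set_system T) (x : T -> V) (S : set V) (M : R) :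
  ProperFilter F -> (\forall t \near F, `|x t| <= M) ->
  (forall p, S p -> exists l : R, `|x t - p| ^+ 2 @[t --> F] --> l) ->
  (forall U z, UltraFilter U -> F `<=` U ->
    (forall y, ip (x t) y @[t --> U] --> ip z y) -> S z) ->
  exists2 z : V, S z & forall y, ip (x t) y @[t --> F] --> ip z y.
Proof.
move=> FF bnd dcvg clS.
have clus U : UltraFilter U -> F `<=` U ->
    exists2 z, S z & forall y, ip (x t) y @[t --> U] --> ip z y.
  move=> UU FU.
  have [z zP] := ultra_weak_cvg_bounded UU (FU _ bnd).
  by exists z => //; exact: clS zP.
have cluniq U1 U2 z w : UltraFilter U1 -> UltraFilter U2 -> F `<=` U1 ->
    F `<=` U2 -> S z -> S w ->
    (forall y, ip (x t) y @[t --> U1] --> ip z y) ->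
    (forall y, ip (x t) y @[t --> U2] --> ip w y) -> z = w.
  move=> UU1 UU2 FU1 FU2 Sz Sw zP wP.
  have [a za] := dcvg _ Sz; have [c wc] := dcvg _ Sw.
  have H : ip (x t) (z - w) @[t --> F]
      --> 2^-1 * (c - a + `|z| ^+ 2 - `|w| ^+ 2).
    rewrite (_ : (fun t => _) = fun t => 2^-1 *
      (`|x t - w| ^+ 2 - `|x t - z| ^+ 2 + `|z| ^+ 2 - `|w| ^+ 2)); last first.
      by apply/funext => t; rewrite !(sqnormB Hip) (ipBr Hip); field.
    apply: cvgM; first exact: cvg_cst.
    apply: cvgB; last exact: cvg_cst.
    by apply: cvgD; [exact: cvgB|exact: cvg_cst].
  have e1 : ip z (z - w) = 2^-1 * (c - a + `|z| ^+ 2 - `|w| ^+ 2).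
    apply: (cvg_unique (@norm_hausdorff _ _) (zP _)).
    by move=> A /H; exact: FU1.
  have e2 : ip w (z - w) = 2^-1 * (c - a + `|z| ^+ 2 - `|w| ^+ 2).
    apply: (cvg_unique (@norm_hausdorff _ _) (wP _)).
    by move=> A /H; exact: FU2.
  apply/eqP; rewrite -subr_eq0 -normr_eq0 -sqrf_eq0 -(ipxx Hip) (ipBl Hip).
  by rewrite e1 e2 subrr.
have [U0 [UU0 FU0]] := ultraFilterLemma FF.
have [z Sz zP] := clus _ UU0 FU0.
(* If convergence fails for [y], the filter [F] restricted to the bad set is still proper. An
   ultrafilter refining it has weak limit [z] by uniqueness, so it contains both the good set and
   the bad one. *)
exists z => // y; apply/cvgrPdist_lt => e e0; apply: contrapT => nF.
set A := (A in ~ F A) in nF.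
have GP : ProperFilter (within (~` A) F).
  apply: Build_ProperFilter => F0; apply: nF.
  have {}F0 : F [set t | (~` A) t -> set0 t] by exact: F0.
  by apply: filterS F0 => t /= nnA; apply: contrapT => /nnA.
have [U [UU GU]] := ultraFilterLemma GP.
have FU : F `<=` U.
  by move=> B FB; apply: GU; apply: filterS FB => t Bt _.
have [w Sw wP] := clus _ UU FU.
have zw : z = w by exact: (cluniq U0 U).
have UA : U A by rewrite -zw in wP; move/cvgrPdist_lt : (wP y); exact.
have WA : F [set t | (~` A) t -> (~` A) t] by apply: filterE => t; exact: id.
have UnA : U (~` A) by exact: GU.
have /filter_ex[t []//] : U (A `&` ~` A) by exact: filterI.
Qed.

End Opial.

(** * Real functions at infinity: monotonicity, Gronwall, Euler operator *)

Lemma nonincreasing_bounded_cvg_pinfty {R : realType} (f : R -> R) (T m : R) :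
  (forall s t, T < s -> s <= t -> f t <= f s) ->
  (forall t, T < t -> m <= f t) -> exists l : R, f t @[t --> +oo] --> l.
Proof.
move=> fni flb.
pose A := f @` [set t | T < t].
have hA : has_inf A.
  split; first by exists (f (T + 1)), (T + 1) => //=; rewrite ltrDl.
  by exists m => _ [t Tt <-]; exact: flb.
exists (inf A); apply/cvgrPdist_lt => e e0.
have [_ [s Ts <-] fs] := inf_adherent e0 hA.
near=> t.
have st : s <= t by near: t; apply: nbhs_pinfty_ge; rewrite num_real.
have ft : f t <= f s by exact: fni.
have lt : inf A <= f t.
  by apply: ge_inf; [case: hA|exists t => //; exact: lt_le_trans Ts st].
rewrite distrC ger0_norm ?subr_ge0// ltrBlDl; exact: le_lt_trans ft fs.
Unshelve. all: by end_near. Qed.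

Lemma nonincreasing_is_derive {R : realType} (f df : R -> R) (T : R) :
  (forall t, T < t -> is_derive t 1 f (df t)) ->
  (forall t, T < t -> df t <= 0) ->
  forall s t, T < s -> s <= t -> f t <= f s.
Proof.
move=> fdf df0 s t Ts st.
have der r : T < r -> derivable f r 1 by move=> /fdf[].
apply: (@ler0_derive1_nincry _ f s) => // [r|r|].
- by rewrite in_itv/= andbT => sr; exact/der/(lt_trans Ts).
- rewrite in_itv/= andbT => sr; rewrite derive1E.
  have Tr := lt_trans Ts sr; have [_ ->] := fdf _ Tr; exact: df0.
- apply: derivable_within_continuous => r; rewrite in_itv/= andbT => sr.
  exact/der/(lt_le_trans Ts).
Qed.

(** With integrating factor [expR (- P t)], the product [expR (- P t) * (1 + E t)] is nonincreasing
    and nonnegative, hence converges. Since [P] is nondecreasing and bounded above, the factor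
    itself has a positive limit and can be divided out. *)
Lemma gronwall_cvg {R : realType} (E dE P p : R -> R) (T K : R) :
  (forall t, T < t -> is_derive t 1 E (dE t)) ->
  (forall t, T < t -> is_derive t 1 P (p t)) ->
  (forall t, T < t -> 0 <= p t) ->
  (forall t, T < t -> P t <= K) ->
  (forall t, T < t -> 0 <= E t) ->
  (forall t, T < t -> dE t <= p t * (1 + E t)) ->
  exists l : R, E t @[t --> +oo] --> l.
Proof.
move=> EdE Pp p0 PK E0 dEle.
have [k Pk] : exists k : R, (- P t) @[t --> +oo] --> k.
  apply: (@nonincreasing_bounded_cvg_pinfty _ _ T (- K)) => [|t Tt]; last first.
    by rewrite lerN2 PK.
  apply: (@nonincreasing_is_derive _ _ (fun t => - p t)) => t Tt.
    by have := Pp _ Tt => ?; exact: is_deriveN.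
  by rewrite oppr_le0 p0.
have [l Gl] : exists l : R, (expR (- P t) * (1 + E t)) @[t --> +oo] --> l.
  apply: (@nonincreasing_bounded_cvg_pinfty _ _ T 0) => [|t Tt]; last first.
    by rewrite mulr_ge0 ?expR_ge0// addr_ge0// E0.
  apply: (@nonincreasing_is_derive _ _
    (fun t => expR (- P t) * (dE t - p t * (1 + E t)))) => t Tt.
    have Pt := Pp _ Tt; have Et := EdE _ Tt.
    have dexp : is_derive t 1 (fun s => expR (- P s)) (- p t * expR (- P t)).
      rewrite mulrC; apply: is_derive1_comp.
    have H : is_derive t 1 (fun s => 1 + E s) (dE t).
      by rewrite -[dE t]add0r; apply: is_deriveD; exact: is_derive_cst.
    apply: (is_derive_eq (is_deriveM dexp H)).
    by rewrite /GRing.scale/=; ring.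
  by rewrite mulr_ge0_le0 ?expR_ge0// subr_le0 dEle.
exists (l * (expR k)^-1 - 1).
have ek : expR (- P t) @[t --> +oo] --> expR k.
  by apply: continuous_cvg Pk; exact: continuous_expR.
have -> : E = fun t => (expR (- P t) * (1 + E t)) * (expR (- P t))^-1 - 1.
  by apply/funext => t; field; rewrite gt_eqF ?expR_gt0.
apply: cvgB; last exact: cvg_cst.
by apply: cvgM => //; apply: cvgV => //; rewrite gt_eqF ?expR_gt0.
Qed.

(* [t h' + c h] is [t^(1-c)] times the derivative of [t^c h]. *)
Lemma euler_operator_upper {R : realType} (h dh : R -> R) (T c l e : R) :
  0 < T -> 0 < c -> 0 < e -> (forall t, T < t -> is_derive t 1 h (dh t)) ->
  (t * dh t + c * h t) @[t --> +oo] --> l ->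
  \forall t \near +oo, h t < l / c + e.
Proof.
move=> T0 c0 e0 hdh hl.
(* With this slack [(l + d) / c = l / c + e / 2]; the other [e / 2] absorbs the decaying term
   [K / t^c]. *)
pose d := c * e / 2.
have d0 : 0 < d by rewrite divr_gt0// mulr_gt0.
have [T1 [_ hT1]] : \forall t \near +oo, t * dh t + c * h t < l + d.
  by apply: (cvgr_lt _ hl); rewrite ltrDl.
pose S := Num.max T T1.
have ST : T <= S by rewrite le_max lexx.
have ST1 : T1 <= S by rewrite le_max lexx orbT.
pose G t := t `^ c * (h t - (l + d) / c).
have Gni s t : S < s -> s <= t -> G t <= G s.
  apply: (@nonincreasing_is_derive _ _
    (fun t => t `^ (c - 1) * (t * dh t + c * h t - (l + d)))) => {s t} t St.
    have t0 : 0 < t by exact: lt_trans T0 (le_lt_trans ST St).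
    have dp := is_derive1_powR c t0.
    have ht := hdh _ (le_lt_trans ST St).
    have H : is_derive t 1 (fun t => h t - (l + d) / c) (dh t).
      by rewrite -[dh t]subr0; apply: is_deriveB.
    apply: (is_derive_eq (is_deriveM dp H)).
    rewrite /GRing.scale/= -(mulr_powRB1 (ltW t0) c0).
    by field; rewrite gt_eqF.
  rewrite mulr_ge0_le0 ?powR_ge0// subr_le0; apply/ltW/hT1.
  exact: le_lt_trans ST1 St.
pose K := G (S + 1).
(* Chosen so that [K < X * (e / 2)]; once [t] exceeds the [c]-th root of [X], also
   [K < t^c * (e / 2)]. *)
pose X := `|2 * K / e| + 1.
have X0 : 0 < X by rewrite ltr_wpDl.
near=> t.
have S1t : S + 1 <= t by near: t; apply: nbhs_pinfty_ge; rewrite num_real.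
have t0 : 0 < t.
  by apply: lt_le_trans S1t; rewrite addr_gt0// (lt_le_trans T0).
have Xt : X `^ c^-1 <= t by near: t; apply: nbhs_pinfty_ge; rewrite num_real.
have Xtc : X <= t `^ c.
  have := ge0_ler_powR (ltW c0) (powR_ge0 X c^-1) (ltW t0) Xt.
  by rewrite -powRrM mulVf ?gt_eqF// powRr1// ltW.
have : G t <= K by apply: Gni => //; rewrite ltrDl.
rewrite /G => Gt.
have KX : K < t `^ c * (e / 2).
  apply: (@lt_le_trans _ _ (X * (e / 2))); last first.
    by rewrite ler_pM2r// divr_gt0.
  have -> : K = (2 * K / e) * (e / 2) by field; rewrite gt_eqF.
  rewrite ltr_pM2r ?divr_gt0// /X (le_lt_trans (ler_norm _))// ltrDl//.
have tc : 0 < t `^ c by rewrite powR_gt0.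
have : h t - (l + d) / c < e / 2.
  by rewrite -(ltr_pM2l tc); exact: le_lt_trans KX.
have -> : (l + d) / c = l / c + e / 2 by rewrite /d; field; rewrite gt_eqF.
move: (l / c) => lc; lra.
Unshelve. all: by end_near. Qed.

(** The one-sided estimate is applied to [h] and to [- h]. *)
Lemma cvg_euler_operator {R : realType} (h dh : R -> R) (T c l : R) :
  0 < T -> 0 < c -> (forall t, T < t -> is_derive t 1 h (dh t)) ->
  (t * dh t + c * h t) @[t --> +oo] --> l -> h t @[t --> +oo] --> l / c.
Proof.
move=> T0 c0 hdh hl; apply/cvgrPdist_lt => e e0.
have up := euler_operator_upper T0 c0 e0 hdh hl.
have Nhdh t : T < t -> is_derive t 1 (fun s => - h s) (- dh t).
  by move=> /hdh ?; exact: is_deriveN.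
have Nhl : (t * - dh t + c * - h t) @[t --> +oo] --> - l.
  rewrite (_ : (fun t => _) = fun t => - (t * dh t + c * h t)); last first.
    by apply/funext => t; ring.
  exact: cvgN.
have lo := euler_operator_upper T0 c0 e0 Nhdh Nhl.
near=> t.
have ut : h t < l / c + e by near: t.
have : - h t < - l / c + e by near: t.
rewrite mulNr distrC ltr_norml; move: (l / c) ut => lc ut lt.
by apply/andP; split; lra.
Unshelve. all: by end_near. Qed.

(** * Integrability of the perturbation *)

Lemma primitive_bounded {R : realType} (q : R -> R) (t0 : R) :
  (@lebesgue_measure R).-integrable [set t | t0 <= t] (EFin \o q) ->
  (forall t, t0 <= t -> 0 <= q t) ->
  (forall t, t0 < t -> {for t, continuous q}) ->
  exists P : R -> R, exists K : R,
    (forall t, t0 < t -> is_derive t 1 P (q t)) /\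
    (forall t, t0 < t -> P t <= K).
Proof.
move=> qint q0 qc.
have mD : measurable [set t : R | t0 <= t].
  by rewrite -set_itvcy; exact: measurable_itv.
have sub u : [set` `[t0, u]] `<=` [set t | t0 <= t].
  by move=> t /=; rewrite in_itv/= => /andP[].
have qintu u : (@lebesgue_measure R).-integrable [set` `[t0, u]] (EFin \o q).
  refine (@integrableS _ _ _ (@lebesgue_measure R) [set t | t0 <= t] _ _ _ _
    (sub u) qint); [exact: mD|exact: measurable_itv].
pose P y := \int[lebesgue_measure]_(t in [set` `[t0, y]]) q t.
exists P.
(* As [q] is nonnegative, the integral over the whole half-line dominates every [P t]. *)
exists (\int[lebesgue_measure]_(t in [set t | t0 <= t]) q t).
split=> t tt0.
  have tt1 : t < t + 1 by rewrite ltrDl.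
  have [dP DP] : derivable P t 1 /\ (P^`())%classic t = q t.
    exact: (continuous_FTC1_closed tt1 (qintu _) tt0 (qc _ tt0)).
  split; first exact: dP.
  by rewrite -derive1E.
rewrite /P /Rintegral; apply: fine_le.
- by apply: integrable_fin_num => //; exact: measurable_itv.
- exact: integrable_fin_num.
apply: (@ge0_subset_integral _ _ _ (@lebesgue_measure R)) => //.
by case/integrableP: qint.
Qed.

(** Domination by the heavier weight; continuity of [e] supplies measurability. *)
Lemma weighted_norm_integrable {R : realType} {V : normedModType R} (e : R -> V)
    (m : R -> R) (t0 : R) : 0 < t0 ->
  {within [set t | t0 <= t], continuous e} ->
  (forall t, t0 <= t -> t <= m t) ->
  (@lebesgue_measure R).-integrable [set t | t0 <= t]
    (fun t => (m t * `|e t|)%:E) ->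
  (@lebesgue_measure R).-integrable [set t | t0 <= t]
    (EFin \o (fun t => t * `|e t|)).
Proof.
move=> t00 ec tm; apply: le_integrable.
- by rewrite -set_itvcy; exact: measurable_itv.
- apply/measurable_EFinP; apply: subspace_continuous_measurable_fun.
    by rewrite -set_itvcy; exact: measurable_itv.
  move=> t; apply: cvgM; last by apply: cvg_norm; exact: ec.
  by apply: continuous_subspaceT => s; exact: cvg_id.
- move=> t /= t0t; rewrite lee_fin; have t1 := lt_le_trans t00 t0t.
  rewrite !normrM normr_id ler_wpM2r// !gtr0_norm// ?tm//.
  exact: lt_le_trans t1 (tm _ t0t).
Qed.

(** * Smooth convex functions *)

Section SmoothConvex.
Context {R : realType} {V : normedModType R} {ip : V -> V -> R}.
Hypothesis Hip : is_Hilbert_inner ip.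
Variables (f : V -> R) (gradf : V -> V).
Hypothesis Hconv : convex_fun f.
Hypothesis Hdiff : forall y : V,
  differentiable f y /\ forall h : V, 'd f y h = ip (gradf y) h.

(** By convexity the difference quotients of [f] at [y] towards [z] are at most [f z - f y] for
    steps in []0, 1[]; the step then tends to 0 from the right. *)
Lemma gradient_inequality y z : f y + ip (gradf y) (z - y) <= f z.
Proof.
have [df dfE] := Hdiff y.
rewrite -lerBrDl -dfE -deriveE//.
have dv : (fun h : R => h^-1 *: (f (h *: (z - y) + y) - f y)) @ 0^'
    --> 'D_(z - y) f y by exact: (diff_derivable df).
have dv' : (fun h : R => h^-1 *: (f (h *: (z - y) + y) - f y)) @ 0^'+
    --> 'D_(z - y) f y.
  move=> A /dv hA.
  have {}hA : nbhs (0 : R)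
    [set h | h != 0 -> A (h^-1 *: (f (h *: (z - y) + y) - f y))] by exact: hA.
  by apply: filterS hA => h hA h0; apply: hA; rewrite gt_eqF.
apply: (cvgr_to_le dv'); near=> h.
have h0 : 0 < h by near: h; exact: nbhs_right_gt.
have h1 : h < 1 by near: h; exact: nbhs_right_lt.
have -> : h *: (z - y) + y = h *: z + (1 - h) *: y.
  by rewrite scalerBr scalerBl scale1r addrAC addrA.
change (h^-1 * (f (h *: z + (1 - h) *: y) - f y) <= f z - f y).
rewrite ler_pdivrMl//.
have hh : 0 <= h <= 1 by rewrite !ltW.
have := Hconv z y hh; lra.
Unshelve. all: by end_near. Qed.

(** A gradient step of length [1 / (2 L)] from [y] changes the gradient by at most [|g| / 2], so the
    gradient inequality at the new point [w] gives a decrease of at least [|g|^2 / (4 L)], while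
    [f w] cannot fall below [f p]. *)
Lemma sqnorm_grad_le (L : R) (p y : V) : 0 < L ->
  (forall y z : V, `|gradf y - gradf z| <= L * `|y - z|) ->
  (forall y, f p <= f y) -> `|gradf y| ^+ 2 <= 4 * L * (f y - f p).
Proof.
move=> L0 HLip pmin.
set g := gradf y; pose s := (2 * L)^-1.
have s0 : 0 < s by rewrite invr_gt0 mulr_gt0.
pose w := y - s *: g.
have yw : y - w = s *: g by rewrite /w opprB addrC subrK.
have H1 := pmin w.
have := gradient_inequality w y; rewrite yw (ipZr Hip) => H2.
have H3 : `|gradf w - g| <= 2^-1 * `|g|.
  apply: le_trans (HLip _ _) _; rewrite distrC yw normrZ gtr0_norm//.
  by rewrite mulrA le_eqVlt; apply/orP; left; apply/eqP; congr (_ * _);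
    rewrite /s; field; rewrite gt_eqF.
have H4 : - (2^-1 * `|g| ^+ 2) <= ip (gradf w - g) g.
  rewrite lerNl; apply: le_trans (ipN_le Hip _ _) _.
  by rewrite expr2 mulrA ler_wpM2r.
have H5 : 2^-1 * `|g| ^+ 2 <= ip (gradf w) g.
  by move: H4; rewrite (ipBl Hip) (ipxx Hip); lra.
have H6 : s * (2^-1 * `|g| ^+ 2) <= f y - f p.
  by have := ler_wpM2l (ltW s0) H5; lra.
have -> : `|g| ^+ 2 = 4 * L * (s * (2^-1 * `|g| ^+ 2)).
  by rewrite /s; field; rewrite gt_eqF.
by rewrite ler_wpM2l// mulr_ge0// ltW.
Qed.

End SmoothConvex.

(** * The perturbed flow and its energy estimate *)

Section PerturbedFlow.
Context {R : realType} {V : completeNormedModType R} {ip : V -> V -> R}.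
Hypothesis Hip : is_Hilbert_inner ip.
Variables (f : V -> R) (gradf : V -> V) (L : R).
Hypothesis L_gt0 : 0 < L.
Hypothesis Hconv : convex_fun f.
Hypothesis Hdiff : forall y : V,
  differentiable f y /\ forall h : V, 'd f y h = ip (gradf y) h.
Hypothesis HLip : forall y z : V, `|gradf y - gradf z| <= L * `|y - z|.
Variables (t0 alpha gamma beta : R).
Hypotheses (t0_gt0 : 0 < t0) (alpha_gt3 : 3 < alpha) (gamma_gt0 : 0 < gamma).
Hypothesis beta_ge0 : 0 <= beta.
Variables (e x : R -> V).
Hypothesis Hx1 : forall t, t0 < t -> derivable x t 1.
Hypothesis Hx2 : forall t, t0 < t -> derivable ('D_1 x) t 1.
Hypothesis Hode : forall t, t0 < t ->
  'D_1 ('D_1 x) t + (alpha / t) *: 'D_1 x t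
    + gradf (x t + betaf gamma beta t *: 'D_1 x t) + e t = 0.

Let dx := 'D_1 x.
Let B := betaf gamma beta.
Let y t := x t + B t *: dx t.
Let g t := gradf (y t).

Lemma acceleration t : t0 < t -> 'D_1 dx t = - (alpha / t) *: dx t - g t - e t.
Proof.
move=> /Hode H; apply/eqP; rewrite -subr_eq0 -[X in _ == X]H; apply/eqP.
by rewrite scaleNr !opprD !opprK !addrA.
Qed.

Lemma is_derive_x t : t0 < t -> is_derive t 1 x (dx t).
Proof. by move=> /Hx1 ?; exact: derivableP. Qed.

Lemma is_derive_dx t : t0 < t -> is_derive t 1 dx ('D_1 dx t).
Proof. by move=> /Hx2 ?; exact: derivableP. Qed.

Lemma is_derive_y t : t0 < t ->
  is_derive t 1 y ((1 - beta / t ^+ 2) *: dx t + B t *: 'D_1 dx t).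
Proof.
move=> tt0; have t_gt0 := lt_trans t0_gt0 tt0.
have dxt := is_derive_x tt0; have ddx := is_derive_dx tt0.
have dB : is_derive t 1 B (- (beta / t ^+ 2)).
  have t_neq0 : t != 0 by rewrite gt_eqF.
  have dV : is_derive t 1 (fun s : R => s^-1) (- t ^- 2).
    apply: DeriveDef; first exact: (@derivableV _ _ id).
    by rewrite (@deriveV _ _ id)// derive_id /GRing.scale/= mulr1.
  apply: (is_derive_eq (is_deriveD (is_derive_cst gamma t 1)
    (is_deriveZ beta dV))).
  by rewrite /GRing.scale/=; field.
have dZ : is_derive t 1 (fun s => B s *: dx s)
    (- (beta / t ^+ 2) *: dx t + B t *: 'D_1 dx t).
  exact: is_derive_scale.
apply: (is_derive_eq (is_deriveD dxt dZ)).
by rewrite addrA scalerBl scale1r scaleNr.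
Qed.

Lemma is_derive_fy t : t0 < t -> is_derive t 1 (f \o y)
  (ip (g t) ((1 - beta / t ^+ 2) *: dx t + B t *: 'D_1 dx t)).
Proof.
move=> tt0; have [dy1 dy2] := is_derive_y tt0.
have [df dfE] := Hdiff (y t).
have dy := (derivable1_diffP y t).1 dy1.
have dfy : differentiable (f \o y) t by exact: differentiable_comp.
apply: DeriveDef; first exact/derivable1_diffP.
by rewrite deriveE// diff_comp//= -dfE -dy2 deriveE.
Qed.

Variable p : V.
Hypothesis p_min : forall z, f p <= f z.

Let W t := t * ip (x t - p) (dx t)
  + (alpha - 1) * (2^-1 * ip (x t - p) (x t - p)).

(* Written so as to be affine in [b], with slope [W]; [energyE] gives the form
   that is a sum of nonnegative terms. *)
Let energy b t :=
  t ^+ 2 * (f (y t) - f p) + 2^-1 * t ^+ 2 * ip (dx t) (dx t) + b * W t.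

Lemma energyE b t : energy b t = t ^+ 2 * (f (y t) - f p)
  + 2^-1 * `|b *: (x t - p) + t *: dx t| ^+ 2
  + 2^-1 * b * (alpha - 1 - b) * `|x t - p| ^+ 2.
Proof.
rewrite /energy /W -!(ipxx Hip); move: (x t - p) => u.
rewrite !(ipDl Hip) !(ipDr Hip) !(ipZl Hip) !(ipZr Hip).
by rewrite !(ipC Hip (dx t) u); field.
Qed.

(** The derivative as the product rule gives it, with [x''] still present; [denergyE] eliminates
    [x''] through the equation. *)
Let denergy b t :=
  2 * t * (f (y t) - f p)
  + t ^+ 2 * ip (g t) ((1 - beta / t ^+ 2) *: dx t + B t *: 'D_1 dx t)
  + t * ip (dx t) (dx t) + t ^+ 2 * ip (dx t) ('D_1 dx t)
  + b * (alpha * ip (x t - p) (dx t)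
         + t * (ip (dx t) (dx t) + ip (x t - p) ('D_1 dx t))).

Lemma is_derive_half_sqdist t : t0 < t ->
  is_derive t 1 (fun s => 2^-1 * ip (x s - p) (x s - p)) (ip (x t - p) (dx t)).
Proof.
move=> tt0; have dxt := is_derive_x tt0.
have du : is_derive t 1 (fun s => x s - p) (dx t).
  by rewrite -[dx t]subr0; apply: is_deriveB; exact: is_derive_cst.
have duu := is_derive_ip Hip du du.
apply: (is_derive_eq (is_deriveZ (2^-1 : R) duu)).
by rewrite (ipC Hip (dx t)) /GRing.scale/=; field.
Qed.

Lemma is_derive_energy b t : t0 < t -> is_derive t 1 (energy b) (denergy b t).
Proof.
move=> tt0; have dxt := is_derive_x tt0; have ddx := is_derive_dx tt0.
have du : is_derive t 1 (fun s => x s - p) (dx t).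
  by rewrite -[dx t]subr0; apply: is_deriveB; exact: is_derive_cst.
have dux := is_derive_ip Hip du ddx.
have dxx := is_derive_ip Hip ddx ddx.
have duu := is_derive_half_sqdist tt0.
have dF : is_derive t 1 (fun s => f (y s) - f p)
    (ip (g t) ((1 - beta / t ^+ 2) *: dx t + B t *: 'D_1 dx t)).
  apply: (is_derive_eq (is_deriveB (is_derive_fy tt0)
    (is_derive_cst (f p) t 1))).
  by rewrite subr0.
have did : is_derive t 1 (fun s : R => s) 1 by exact: is_derive_id.
have d2 : is_derive t 1 (fun s : R => s ^+ 2) (2 * t).
  by apply: (is_derive_eq (is_deriveX 2 did)); rewrite /GRing.scale/=; ring.
have d2h : is_derive t 1 (fun s : R => 2^-1 * s ^+ 2) t.
  by apply: (is_derive_eq (is_deriveZ (2^-1 : R) d2));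
    rewrite /GRing.scale/=; field.
have dW : is_derive t 1 W (ip (x t - p) (dx t)
    + t * (ip (dx t) (dx t) + ip (x t - p) ('D_1 dx t))
    + (alpha - 1) * ip (x t - p) (dx t)).
  apply: (is_derive_eq (is_deriveD (is_deriveM did dux)
    (is_deriveZ (alpha - 1) duu))).
  by rewrite /GRing.scale/=; ring.
apply: (is_derive_eq (is_deriveD (is_deriveD (is_deriveM d2 dF)
  (is_deriveM d2h dxx)) (is_deriveZ b dW))).
by rewrite /denergy (ipC Hip ('D_1 dx t)) /GRing.scale/=; field.
Qed.

(** The leading terms [t^2 <g, x'>] cancel, as do the terms in [<x - p, x'>]. The dissipation
    [- t^2 B |g|^2] arises from [B x''] inside [y']. The [b t] term is kept grouped because its
    bracket is [<g, y - p>], which convexity bounds below. *)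
Lemma denergyE b t : t0 < t -> denergy b t =
  2 * t * (f (y t) - f p)
  + ((b - alpha) * gamma * t + (b - alpha - 1) * beta) * ip (g t) (dx t)
  - t ^+ 2 * B t * `|g t| ^+ 2 - (alpha - 1 - b) * t * `|dx t| ^+ 2
  - b * t * (ip (g t) (x t - p) + B t * ip (g t) (dx t))
  - t * ip (e t) (b *: (x t - p) + t *: dx t) - t ^+ 2 * B t * ip (e t) (g t).
Proof.
move=> tt0; have t_neq0 : t != 0 by rewrite gt_eqF// (lt_trans t0_gt0).
rewrite /denergy (acceleration tt0) -!(ipxx Hip).
move: (x t - p) => u.
rewrite !(ipE Hip) (ipC Hip (dx t) (g t)) (ipC Hip (dx t) (e t)).
rewrite (ipC Hip u (g t)) (ipC Hip u (e t)) (ipC Hip (g t) (e t)).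
by rewrite /B /betaf; field.
Qed.

Lemma energy_ge b t : 0 <= b <= alpha - 1 ->
  t ^+ 2 * (f (y t) - f p) <= energy b t /\
  2^-1 * `|b *: (x t - p) + t *: dx t| ^+ 2 <= energy b t /\
  2^-1 * b * (alpha - 1 - b) * `|x t - p| ^+ 2 <= energy b t.
Proof.
move=> /andP[b0 ba]; rewrite energyE.
have F0 : 0 <= t ^+ 2 * (f (y t) - f p) by rewrite mulr_ge0 ?sqr_ge0// subr_ge0.
have v0 : 0 <= 2^-1 * `|b *: (x t - p) + t *: dx t| ^+ 2.
  by rewrite mulr_ge0 ?sqr_ge0// invr_ge0.
have u0 : 0 <= 2^-1 * b * (alpha - 1 - b) * `|x t - p| ^+ 2.
  by rewrite !mulr_ge0 ?sqr_ge0 ?invr_ge0 ?subr_ge0.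
by split; [|split]; lra.
Qed.

Lemma denergy_le b : 2 <= b < alpha - 1 ->
  exists2 T, t0 <= T & forall t, T < t -> denergy b t <=
    (1 + (gamma + beta) * (1 + 2 * L)) * (t * `|e t|) * (1 + energy b t).
Proof.
move=> /andP[b2 ba].
(* [kappa] is the friction left for [t |x'|^2], [C1 * t] bounds the cross coefficient for [t >= 1],
   and [q] completes the square [kappa (|x'| - q |g|)^2]. The last threshold below gives
   [kappa q^2 <= gamma t], so the remainder fits into the dissipation. *)
pose kappa := alpha - 1 - b.
have kappa_gt0 : 0 < kappa by rewrite subr_gt0.
pose C1 := (alpha - b) * gamma + (alpha + 1 - b) * beta.
pose q := C1 / (2 * kappa).
have C1E : C1 = 2 * kappa * q.
  by rewrite /q; field; rewrite gt_eqF.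
exists (Num.max t0 (Num.max 1 (kappa * q ^+ 2 / gamma))).
  by rewrite le_max lexx.
move=> t; rewrite !gt_max => /and3P[tt0 t1].
rewrite ltr_pdivrMr// => tq.
have t_gt0 : 0 < t by exact: lt_trans t0_gt0 tt0.
have [] := @energy_ge b t; first by apply/andP; split; lra.
move=> EF [Ev Eu].
have B_ge : gamma <= B t by rewrite /B /betaf lerDl divr_ge0// ltW.
have B_le : B t <= gamma + beta.
  by rewrite /B /betaf lerD2l ler_pdivrMr// ler_peMr// ltW.
have B_gt0 := lt_le_trans gamma_gt0 B_ge.
have hk : f (y t) - f p <= ip (g t) (x t - p) + B t * ip (g t) (dx t).
  have := gradient_inequality Hconv Hdiff (y t) p.
  rewrite -/(g t) (_ : p - y t = - ((x t - p) + B t *: dx t)); last first.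
    by rewrite /y !opprD opprK addrA [p - _]addrC.
  by rewrite (ipNr Hip) (ipDr Hip) (ipZr Hip); lra.
have hg := sqnorm_grad_le Hip Hconv Hdiff (y t) L_gt0 HLip p_min.
rewrite -/(g t) in hg.
rewrite (denergyE _ tt0).
set F := f (y t) - f p in EF hk hg *.
have F_ge0 : 0 <= F by rewrite subr_ge0.
have hc : - ip (g t) (dx t) <= `|g t| * `|dx t| by exact: ipN_le.
have hv : - ip (e t) (b *: (x t - p) + t *: dx t)
    <= `|e t| * `|b *: (x t - p) + t *: dx t| by exact: ipN_le.
have hge : - ip (e t) (g t) <= `|e t| * `|g t| by exact: ipN_le.
(* From here on all norms and inner products are abstracted to real numbers, leaving pure arithmetic
   with the recorded inequalities. *)
move: (`|b *: (x t - p) + t *: dx t|) (normr_ge0 (b *: (x t - p) + t *: dx t))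
  (ip (e t) (b *: (x t - p) + t *: dx t)) Ev hv => nv nv0 ev Ev hv.
move: (ip (g t) (x t - p) + B t * ip (g t) (dx t)) hk => k hk.
move: (ip (g t) (dx t)) hc => c hc.
move: (ip (e t) (g t)) hge => eg hge.
move: (`|g t|) (normr_ge0 (g t)) hg hc hge => ng ng0 hg hc hge.
move: (`|dx t|) (normr_ge0 (dx t)) hc => nd nd0 hc.
move: (`|e t|) (normr_ge0 (e t)) hv hge => ne ne0 hv hge.
move: (energy b t) EF Ev Eu => E EF Ev Eu.
move: (B t) B_ge B_le B_gt0 => Bt B_ge B_le B_gt0 {Eu}.
move: F F_ge0 hk hg EF => F F_ge0 hk hg EF.
have E0 : 0 <= E by apply: le_trans EF; rewrite mulr_ge0 ?sqr_ge0.
have t_ge0 := ltW t_gt0; have Bt_ge0 := ltW B_gt0.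
have b_ge0 : 0 <= b by lra.
have kappa_ge0 := ltW kappa_gt0; have gamma_ge0 := ltW gamma_gt0.
have L_ge0 := ltW L_gt0.
(* Here [2 <= b] enters: [F <= k] by convexity, and [F] is nonnegative. *)
have S0 : (2 * t * F - b * t * k) <= 0.
  have : b * t * F <= b * t * k by rewrite ler_wpM2l// mulr_ge0.
  have : 2 * (t * F) <= b * (t * F) by rewrite ler_wpM2r// mulr_ge0.
  lra.
have S1 : ((b - alpha) * gamma * t + (b - alpha - 1) * beta) * c
    <= C1 * t * (ng * nd).
  have r1 : 0 <= (alpha - b) * gamma * t + (alpha + 1 - b) * beta.
    by rewrite addr_ge0// !mulr_ge0//; lra.
  have r2 : (alpha - b) * gamma * t + (alpha + 1 - b) * beta <= C1 * t.
    have : (alpha + 1 - b) * beta <= (alpha + 1 - b) * beta * t.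
      by rewrite ler_peMr ?(ltW t1)// mulr_ge0//; lra.
    by rewrite /C1; lra.
  have := ler_wpM2l r1 hc; have := ler_wpM2r (mulr_ge0 ng0 nd0) r2; lra.
have S2 : C1 * t * (ng * nd) <= kappa * t * nd ^+ 2 + t ^+ 2 * Bt * ng ^+ 2.
  have : 0 <= kappa * t * (nd - q * ng) ^+ 2.
    by rewrite mulr_ge0 ?sqr_ge0// mulr_ge0.
  have : kappa * q ^+ 2 * (t * ng ^+ 2) <= t * gamma * (t * ng ^+ 2).
    by rewrite ler_wpM2r ?(ltW tq)// mulr_ge0 ?sqr_ge0.
  have : gamma * (t ^+ 2 * ng ^+ 2) <= Bt * (t ^+ 2 * ng ^+ 2).
    by rewrite ler_wpM2r// mulr_ge0 ?sqr_ge0.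
  by rewrite C1E; lra.
have S3 : - (t * ev) <= t * ne * (1 + E).
  have nvE : nv <= 1 + E by have := sqr_ge0 (nv - 1); lra.
  have := ler_wpM2l (ltW t_gt0) hv.
  have := ler_wpM2l (mulr_ge0 (ltW t_gt0) ne0) nvE; lra.
have S4 : - (t ^+ 2 * Bt * eg)
    <= (gamma + beta) * (1 + 2 * L) * (t * ne * (1 + E)).
  (* From [2 t |g| <= 1 + t^2 |g|^2] and [|g|^2 <= 4 L F]; the weight [t] on [|e|] thus suffices for
     the term [t^2 B <e, g>]. *)
  have tng : t * ng <= (1 + 2 * L) * (1 + E).
    have : t ^+ 2 * ng ^+ 2 <= 4 * L * E.
      have := ler_wpM2l (sqr_ge0 t) hg.
      have := ler_wpM2l (mulr_ge0 (ler0n R 4) (ltW L_gt0)) EF; lra.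
    have := sqr_ge0 (t * ng - 1); have := mulr_ge0 (ltW L_gt0) E0; lra.
  have a1 := ler_wpM2l (mulr_ge0 (sqr_ge0 t) (ltW B_gt0)) hge.
  have a2 : t * ng * (Bt * (t * ne)) <= (1 + 2 * L) * (1 + E) * (Bt * (t * ne)).
    by rewrite ler_wpM2r// !mulr_ge0.
  have a3 : Bt * ((1 + 2 * L) * (1 + E) * (t * ne))
      <= (gamma + beta) * ((1 + 2 * L) * (1 + E) * (t * ne)).
    by rewrite ler_wpM2r// !mulr_ge0// addr_ge0// mulr_ge0.
  lra.
rewrite -/kappa; lra.
Qed.

(** * Asymptotics of the flow under an integrable perturbation *)

Variables (P : R -> R) (K : R).
Hypothesis P_der : forall t, t0 < t -> is_derive t 1 P (t * `|e t|).
Hypothesis P_le : forall t, t0 < t -> P t <= K.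

Lemma energy_cvg b : 2 <= b < alpha - 1 ->
  exists l : R, energy b t @[t --> +oo] --> l.
Proof.
move=> hb; have [T t0T HT] := denergy_le hb.
have /andP[b2 ba] := hb.
pose C := 1 + (gamma + beta) * (1 + 2 * L).
have C0 : 0 <= C.
  by rewrite !addr_ge0// !mulr_ge0 ?addr_ge0 ?mulr_ge0 ?(ltW gamma_gt0)
    ?(ltW L_gt0).
apply: (@gronwall_cvg _ _ (denergy b) (fun t => C * P t)
  (fun t => C * (t * `|e t|)) T (C * K)) => t Tt.
- exact/is_derive_energy/(le_lt_trans t0T).
- have dP := P_der (le_lt_trans t0T Tt).
  exact: (is_deriveZ C dP).
- rewrite !mulr_ge0// ltW//; exact: lt_trans t0_gt0 (le_lt_trans t0T Tt).
- by rewrite ler_wpM2l// P_le// (le_lt_trans t0T).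
- have [|H _] := @energy_ge b t; first by apply/andP; split; lra.
  by apply: le_trans H; rewrite mulr_ge0 ?sqr_ge0// subr_ge0.
- exact: HT.
Qed.

Lemma sqdist_cvg : exists l : R, `|x t - p| ^+ 2 @[t --> +oo] --> l.
Proof.
(* The midpoint of 2 and [alpha - 1], distinct from 2 because [alpha > 3]; [W] is then recovered
   from two converging energies. *)
pose b := (alpha + 1) / 2.
have [|l2 E2] := @energy_cvg 2; first by rewrite lexx/=; move: alpha_gt3; lra.
have [|lb Eb] := @energy_cvg b; first by rewrite /b; move: alpha_gt3; lra.
have b2 : b - 2 != 0 by rewrite gt_eqF// subr_gt0 /b; move: alpha_gt3; lra.
have HW : W t @[t --> +oo] --> (b - 2)^-1 * (lb - l2).
  rewrite (_ : W = fun t => (b - 2)^-1 * (energy b t - energy 2 t)).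
    by apply: cvgM; [exact: cvg_cst|exact: cvgB].
  by apply/funext => t; rewrite /energy; field.
have a1 : 0 < alpha - 1 by rewrite subr_gt0; move: alpha_gt3; lra.
have H := cvg_euler_operator t0_gt0 a1 is_derive_half_sqdist HW.
exists (2 * ((b - 2)^-1 * (lb - l2) / (alpha - 1))).
rewrite (_ : (fun t => _) = fun t => 2 * (2^-1 * ip (x t - p) (x t - p))).
  by apply: cvgM; [exact: cvg_cst|exact: H].
by apply/funext => t; rewrite -(ipxx Hip); field.
Qed.

(** All three bounds are read off the energy with [b = 2], where the coefficient of [|x - p|^2] is
    [alpha - 3 > 0]; square roots are avoided through [r <= 1 + r^2]. *)
Lemma trajectory_bounds : exists M : R, \forall t \near +oo,
  [/\ t ^+ 2 * (f (y t) - f p) <= M, `|x t| <= M & t * `|dx t| <= M].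
Proof.
have [|l El] := @energy_cvg 2; first by rewrite lexx/=; move: alpha_gt3; lra.
have El1 : \forall t \near +oo, energy 2 t < l + 1.
  by apply: (cvgr_lt _ El); rewrite ltrDl.
have a3 : 0 < alpha - 3 by rewrite subr_gt0.
pose D := 1 + (l + 1) / (alpha - 3).
pose M := Num.max (l + 1) (Num.max (`|p| + D) (1 + (l + 1) + 2 * D)).
exists M; near=> t.
have t_gt0 : 0 < t by near: t; apply: nbhs_pinfty_gt; rewrite num_real.
have Et : energy 2 t < l + 1 by near: t.
have [|EF [Ev Eu]] := @energy_ge 2 t; first by move: alpha_gt3; lra.
have uD : `|x t - p| <= D.
  have : `|x t - p| ^+ 2 <= (l + 1) / (alpha - 3) by rewrite ler_pdivlMr//; lra.
  rewrite /D; have := sqr_ge0 (`|x t - p| - 1).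
  have := sqr_ge0 (`|x t - p|); lra.
split; rewrite !le_max.
- by rewrite (ltW (le_lt_trans EF Et)).
- apply/orP; right; apply/orP; left.
  have -> : x t = p + (x t - p) by rewrite addrC subrK.
  by apply: le_trans (ler_normD _ _) _; rewrite lerD2l.
- apply/orP; right; apply/orP; right.
  have -> : t * `|dx t| = `|(2 *: (x t - p) + t *: dx t) - 2 *: (x t - p)|.
    by rewrite addrC addKr normrZ gtr0_norm.
  apply: le_trans (ler_normB _ _) _; rewrite normrZ ger0_norm//.
  apply: lerD; last by rewrite ler_wpM2l.
  move: (`|_ + _|) Ev => nv Ev.
  by have := sqr_ge0 (nv - 1); lra.
Unshelve. all: by end_near. Qed.

(** The gradient inequality at the fixed point [z] bounds [f z] by [f y - <h, y - z>] with
    [h = gradf z]. Along [U], [f y] is at most [f p + M / t^2], [<h, x - z>] tends to 0, and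
    [B <h, x'>] is of order [1 / t]. *)
Lemma weak_cluster_point_min (U : set_system R) (z : V) : ProperFilter U ->
  +oo `<=` U -> (forall w, ip (x t) w @[t --> U] --> ip z w) -> f z <= f p.
Proof.
move=> UU FU zP; have [M HM] := trajectory_bounds.
pose h := gradf z.
pose rhs t := f p + M * (t^-1 * t^-1) - (ip (x t) h - ip z h)
  + (gamma + beta) * (M * `|h|) * t^-1.
have Vt : t^-1 @[t --> U] --> (0 : R).
  apply/cvgrPdist_lt => r r0; apply: FU; near=> t.
  have t_gt0 : 0 < t by near: t; apply: nbhs_pinfty_gt; rewrite num_real.
  rewrite sub0r normrN gtr0_norm ?invr_gt0// invf_plt ?posrE//.
  by near: t; apply: nbhs_pinfty_gt; rewrite num_real.
have rl : rhs t @[t --> U] -->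
    f p + M * (0 * 0) - (ip z h - ip z h) + (gamma + beta) * (M * `|h|) * 0.
  apply: cvgD; last by apply: cvgM => //; exact: cvg_cst.
  apply: cvgB; last by apply: cvgB; [exact: zP|exact: cvg_cst].
  apply: cvgD; first exact: cvg_cst.
  by apply: cvgM; [exact: cvg_cst|exact: cvgM].
rewrite !mulr0 subrr subr0 !addr0 in rl.
apply: (cvgr_to_ge rl); apply: FU; near=> t.
have t1 : 1 < t by near: t; apply: nbhs_pinfty_gt; rewrite num_real.
have t_gt0 : 0 < t by rewrite (lt_trans _ t1).
have [EF _ dxM] : [/\ t ^+ 2 * (f (y t) - f p) <= M, `|x t| <= M
  & t * `|dx t| <= M] by near: t.
have B_le : B t <= gamma + beta.
  by rewrite /B /betaf lerD2l ler_pdivrMr// ler_peMr// ltW.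
have B_ge0 : 0 <= B t.
  by rewrite /B /betaf addr_ge0 ?divr_ge0 ?(ltW t_gt0) ?(ltW gamma_gt0).
have := gradient_inequality Hconv Hdiff z (y t).
rewrite -/h /y (ipBr Hip) (ipDr Hip) (ipZr Hip) !(ipC Hip h) -/(y t) => gi.
have F1 : f (y t) - f p <= M * (t^-1 * t^-1).
  by rewrite -invfM -expr2 ler_pdivlMr ?exprn_gt0// mulrC.
have d1 : `|dx t| <= M * t^-1 by rewrite ler_pdivlMr// mulrC.
have B1 : - (B t * ip (dx t) h) <= (gamma + beta) * (M * `|h|) * t^-1.
  rewrite -mulrN; apply: (@le_trans _ _ (B t * (M * t^-1 * `|h|))).
    rewrite ler_wpM2l//; apply: le_trans (ipN_le Hip _ _) _.
    by rewrite ler_wpM2r.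
  rewrite [leRHS](_ : _ = (gamma + beta) * (M * t^-1 * `|h|)); last by ring.
  rewrite ler_wpM2r// mulr_ge0//; exact: le_trans d1.
rewrite /rhs; lra.
Unshelve. all: by end_near. Qed.

End PerturbedFlow.

(** * Weak convergence to a minimizer *)

Unset Implicit Arguments.

Theorem theorem8 (R : realType) (V : completeNormedModType R)
  (ip : V -> V -> R) (Hip : is_Hilbert_inner ip)
  (t0 : R) (Ht0 : 0 < t0)
  (f : V -> R) (gradf : V -> V) (L : R) (HL : 0 < L)
  (Hconv : convex_fun f)
  (Hdiff : forall y : V, differentiable f y /\ forall h : V, 'd f y h = ip (gradf y) h)
  (Hcont : continuous gradf)
  (HLip : forall y z : V, `|gradf y - gradf z| <= L * `|y - z|)
  (Hargmin : exists z : V, forall y : V, f z <= f y)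
  (alpha gamma beta b : R) (Halpha : 3 < alpha) (Hgamma : 0 < gamma)
  (Hbeta : 0 <= beta) (Hb : 0 < b <= alpha - 1)
  (e : R -> V) (He : {within [set t | t0 <= t], continuous e})
  (Hme : (@lebesgue_measure R).-integrable [set t | t0 <= t]
           (fun t => (mf L alpha gamma beta b t * `|e t|)%:E))
  (x : R -> V)
  (Hx1 : forall t, t0 < t -> derivable x t 1)
  (Hx2 : forall t, t0 < t -> derivable ('D_1 x) t 1)
  (Hode : forall t, t0 < t ->
     'D_1 ('D_1 x) t + (alpha / t) *: 'D_1 x t
       + gradf (x t + betaf gamma beta t *: 'D_1 x t) + e t = 0) :
  exists2 z : V, (forall y : V, f z <= f y) &
    forall y : V, ip (x t) y @[t --> +oo] --> ip z y.
Proof.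
have tm t : t0 <= t -> t <= mf L alpha gamma beta b t.
  by move=> _; rewrite /mf le_max lexx.
have qint := weighted_norm_integrable Ht0 He tm Hme.
have q0 t : t0 <= t -> 0 <= t * `|e t|.
  by move=> tt0; rewrite mulr_ge0// (le_trans (ltW Ht0)).
have ec t : t0 < t -> {for t, continuous e}.
  move=> tt0.
  have : {within `]t0, +oo[%classic, continuous e}.
    by apply: continuous_subspaceW He => s /=; rewrite in_itv/= andbT => /ltW.
  rewrite continuous_open_subspace; last exact: interval_open.
  by apply; rewrite inE/= in_itv/= andbT.
have qc t : t0 < t -> {for t, continuous (fun s : R => s * `|e s|)}.
  by move=> tt0; apply: cvgM; [exact: cvg_id|apply: cvg_norm; exact: ec].
have [P [K [P_der P_le]]] := primitive_bounded qint q0 qc.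
have [p p_min] := Hargmin.
have [M HM] := trajectory_bounds Hip HL Hconv Hdiff HLip Ht0 Halpha Hgamma
  Hbeta Hx1 Hx2 Hode p_min P_der P_le.
(* The bound and the cluster point property use one fixed minimizer [p]; convergence of distances is
   obtained for every minimizer [q]. *)
apply: (@opial R V ip Hip R (pinfty_nbhs R) x [set z | forall y, f z <= f y] M).
- by apply: filterS HM => t [].
- move=> q q_min; exact: (sqdist_cvg Hip HL Hconv Hdiff HLip Ht0 Halpha Hgamma
    Hbeta Hx1 Hx2 Hode q_min P_der P_le).
- move=> U z UU FU zP y; apply: le_trans (p_min y).
  exact: (weak_cluster_point_min Hip HL Hconv Hdiff HLip Ht0 Halpha Hgamma
    Hbeta Hx1 Hx2 Hode p_min P_der P_le
    (@ultra_proper _ _ UU) FU zP).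
Qed.
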